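(* Let $u,v:\mathbb{R}^n\to\mathbb{R}$ be two continuous functions satisfying the following in the viscosity sense: $$\begin{cases}\int \frac{F(\delta u(x,y))}{|y|^{n+\sigma}}dy\ge g(x,u-\phi) & \text{in } \mathbb{R}^n\\ u-\phi\to 0 & \text{at }\infty,\end{cases}$$ and $$\begin{cases}\int \frac{F(\delta v(x,y))}{|y|^{n+\sigma}}dy\le g(x,v-\phi) & \text{in } \mathbb{R}^n\\ v-\phi\to 0 & \text{at }\infty.\end{cases}$$ Then $u\le v$ in $\mathbb{R}^n$.
   Context: $n$ is the dimension of the space and $\sigma\in(1,2)$ is fixed. For a function $u$ on $\mathbb{R}^n$, $\delta u(x,y)=u(x+y)+u(x-y)-2u(x)$. Integrals in $dy$ are over $\mathbb{R}^n$. Standing assumptions, with constants $L_1,\dots,L_5$ and $\mu>0$: (i) $F:\mathbb{R}\to\mathbb{R}$ is $C^1$, $F(0)=0$, $\mathrm{Lip}(F)<L_1$, and $F'>0$. (ii) $g:\mathbb{R}^n\times\mathbb{R}\to\mathbb{R}$ satisfies $|g(x,t)-g(x',t)|<L_2|x-x'|$ for $x\ne x'$ and all $t$; $g(x,t)-g(x,s)\ge\mu(t-s)$ whenever $t>s$; and $g(x,0)=0$ for all $x\in\mathbb{R}^n$. (iii) $\phi:\mathbb{R}^n\to\mathbb{R}$ is a convex Lipschitz $C^{1,1}$ function with $0\le D^2\phi\le L_3$, $\mathrm{Lip}(\phi)\le L_4$, and $\int|\phi(y)|\frac{1}{(1+|y|)^{n+\sigma}}dy\le L_5$. Viscosity sense: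 write $I[w,x]=\int\frac{F(\delta w(x,y))}{|y|^{n+\sigma}}dy$ and let $f$ be continuous. An upper semicontinuous function $w$ with $w\in L^1\big(\frac{1}{(1+|y|)^{n+\sigma}}dy\big)$ is a (viscosity) subsolution, i.e. $I[w,x]\ge f(x)$ in $\Omega$ in the viscosity sense, if for any $x\in\Omega$ and any $\eta$ that is $C^{1,1}$ in some open set $U\ni x$ with $\eta(x)=w(x)$ and $\eta\ge w$ in $U$, the function $\tilde\eta$ equal to $\eta$ in $U$ and to $w$ outside $U$ satisfies $I[\tilde\eta,x]\ge f(x)$ in the classical pointwise sense. Supersolutions ($I[w,x]\le f(x)$) are defined analogously, with lower semicontinuous $w$, $\eta\le w$ in $U$ and the reversed inequality. For the right-hand side $g(x,w-\phi)$ one takes $f(x)=g(x,w(x)-\phi(x))$. *)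

(* Defs.v *)
From HB Require Import structures.
From mathcomp Require Import all_boot all_order all_algebra.
From mathcomp Require Import all_classical all_reals all_analysis.

Set Implicit Arguments.
Unset Strict Implicit.
Unset Printing Implicit Defensive.

Import Order.TTheory GRing.Theory Num.Theory.
Import numFieldNormedType.Exports.

Local Open Scope classical_set_scope.
Local Open Scope ring_scope.

Section measurable_rV.
Context d (T : measurableType d) (n : nat).

Let coords : 'I_n -> 'rV[T]_n -> T := fun i x => x ord0 i.

Let rV_set0 : g_sigma_preimage coords set0.
Proof. exact: sigma_algebra0. Qed.

Let rV_setC A : g_sigma_preimage coords A -> g_sigma_preimage coords (~` A).
Proof. exact: sigma_algebraC. Qed.

Let rV_bigcup (A : (set 'rV[T]_n)^nat) :
  (forall i, g_sigma_preimage coords (A i)) ->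
  g_sigma_preimage coords (\bigcup_i (A i)).
Proof. exact: sigma_algebra_bigcup. Qed.

HB.instance Definition _ := @isMeasurable.Build (measure_tuple_display d)
  'rV[T]_n (g_sigma_preimage coords) rV_set0 rV_setC rV_bigcup.

End measurable_rV.


Lemma measurable_coord d (T : measurableType d) n (i : 'I_n) :
  measurable_fun [set: 'rV[T]_n] (fun x : 'rV[T]_n => x ord0 i).
Proof.
move=> _ Y mY; rewrite setTI; apply: sub_sigma_algebra => /=.
rewrite -bigcup_seq/=; exists i => /=; first by rewrite mem_index_enum.
by exists Y => //; rewrite setTI.
Qed.

Lemma measurable_fun_coordP d1 d2 (S : measurableType d1)
    (T : measurableType d2) n (f : S -> 'rV[T]_n) :
  (forall i, measurable_fun [set: S] (fun s => f s ord0 i)) ->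
  measurable_fun [set: S] f.
Proof.
move=> mf _ A; rewrite setTI => mA.
suff : g_sigma_preimage (fun i s => f s ord0 i) `<=` measurable.
  apply; rewrite (@g_sigma_preimage_comp _ _ _ _ (fun i (x : 'rV[T]_n) => x ord0 i)).
  by exists A => //; rewrite setTI.
apply: smallest_sub; first exact: sigma_algebra_measurable.
rewrite -bigcup_seq; apply: bigcup_sub => i _ B [C mC <-]; exact: mf.
Qed.

Section lebesgue_step.
Context {R : realType} (n : nat).
Variable m : {sigma_finite_measure set 'rV[R]_n -> \bar R}.

Definition cons_rV (p : measurableTypeR R * 'rV[R]_n) : 'rV[R]_n.+1 :=
  \row_i oapp (p.2 ord0) p.1 (unlift ord0 i).

Definition uncons_rV (x : 'rV[R]_n.+1) : measurableTypeR R * 'rV[R]_n :=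
  (x ord0 ord0, \row_i x ord0 (lift ord0 i)).

Lemma cons_rV0 p : cons_rV p ord0 ord0 = p.1.
Proof. by rewrite mxE unlift_none. Qed.

Lemma cons_rVS p i : cons_rV p ord0 (lift ord0 i) = p.2 ord0 i.
Proof. by rewrite mxE liftK. Qed.

Lemma uncons_rVK : cancel uncons_rV cons_rV.
Proof.
move=> x; apply/rowP => i; have [j ->|->] := unliftP ord0 i.
  by rewrite cons_rVS mxE.
by rewrite cons_rV0.
Qed.

Lemma cons_rVK : cancel cons_rV uncons_rV.
Proof.
move=> [a y]; rewrite /uncons_rV cons_rV0; apply: (congr1 (pair a)).
by apply/rowP => i; rewrite mxE cons_rVS.
Qed.

Lemma measurable_cons_rV : measurable_fun setT cons_rV.
Proof.
apply: measurable_fun_coordP => i; have [j ->|->] := unliftP ord0 i.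
  under eq_fun do rewrite cons_rVS.
  exact: (measurableT_comp (measurable_coord _) measurable_snd).
under eq_fun do rewrite cons_rV0.
exact: measurable_fst.
Qed.

Lemma measurable_uncons_rV : measurable_fun setT uncons_rV.
Proof.
apply/measurable_fun_pair => /=; first exact: measurable_coord.
apply: measurable_fun_coordP => i; under eq_fun do rewrite mxE.
exact: measurable_coord.
Qed.

Definition lebesgue_cons : set 'rV[R]_n.+1 -> \bar R :=
  pushforward (lebesgue_measure \x m)%E cons_rV.

Let lebesgue_cons0 : lebesgue_cons set0 = 0%E.
Proof. by rewrite /lebesgue_cons /pushforward preimage_set0 measure0. Qed.

Let lebesgue_cons_ge0 A : (0 <= lebesgue_cons A)%E.
Proof. by rewrite /lebesgue_cons /pushforward measure_ge0. Qed.

Let lebesgue_cons_sigma_additive : semi_sigma_additive lebesgue_cons.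
Proof.
move=> F mF tF mUF; rewrite /lebesgue_cons /pushforward preimage_bigcup.
apply: measure_semi_sigma_additive.
- by move=> k; rewrite -[X in measurable X]setTI; exact: measurable_cons_rV.
- apply/trivIsetP => /= i j _ _ ij; rewrite -preimage_setI.
  by move/trivIsetP : tF => /(_ _ _ _ _ ij) ->//; rewrite preimage_set0.
- rewrite -preimage_bigcup -[X in measurable X]setTI.
  exact: measurable_cons_rV.
Qed.

HB.instance Definition _ := isMeasure.Build _ _ _ lebesgue_cons
  lebesgue_cons0 lebesgue_cons_ge0 lebesgue_cons_sigma_additive.

Let lebesgue_cons_sigma_finite : sigma_finite setT lebesgue_cons.
Proof.
have /sigma_finiteP[F [FT ndF Foo]] := sigma_finiteT (@lebesgue_measure R).
have /sigma_finiteP[G [GT ndG Goo]] := sigma_finiteT m.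
exists (fun k => uncons_rV @^-1` (F k `*` G k)).
  rewrite -preimage_bigcup (_ : \bigcup_k _ = setT) ?preimage_setT//.
  apply/seteqP; split => // -[a y] _.
  have [i _ Fa] : (\bigcup_k F k) a by rewrite -FT.
  have [j _ Gy] : (\bigcup_k G k) y by rewrite -GT.
  exists (maxn i j) => //; split => /=.
  - by move: a Fa; exact/subsetPset/ndF/leq_maxl.
  - by move: y Gy; exact/subsetPset/ndG/leq_maxr.
move=> k; have [mF Fk] := Foo k; have [mG Gk] := Goo k; split.
  rewrite -[X in measurable X]setTI.
  by apply: measurable_uncons_rV => //; exact: measurableX.
rewrite /lebesgue_cons /pushforward -comp_preimage.
rewrite (_ : uncons_rV \o cons_rV = id); last first.
  by apply/funext => p /=; rewrite cons_rVK.
rewrite preimage_id product_measure1E//.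
by rewrite lte_mul_pinfty// ge0_fin_numE.
Qed.

HB.instance Definition _ := Measure_isSigmaFinite.Build _ _ _ lebesgue_cons
  lebesgue_cons_sigma_finite.

End lebesgue_step.

(* Lebesgue measure on R^n, on the product (Borel) sigma-algebra; see
   lebesgue_rV_box. *)
Fixpoint lebesgue_rV {R : realType} (n : nat) :
    {sigma_finite_measure set 'rV[R]_n -> \bar R} :=
  match n with
  | 0%N => [the {sigma_finite_measure set 'rV[R]_0 -> \bar R} of dirac (0 : 'rV[R]_0)]
  | k.+1 => [the {sigma_finite_measure set 'rV[R]_k.+1 -> \bar R} of
              lebesgue_cons (lebesgue_rV k)]
  end.

Lemma lebesgue_rV_box (R : realType) (n : nat) (A : 'I_n -> set R) :
  (forall i, measurable (A i)) ->
  lebesgue_rV n [set x | forall i, A i (x ord0 i)] =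
  (\prod_(i < n) (lebesgue_measure (A i) : \bar R))%E.
Proof.
elim: n A => [|n IHn] A mA.
  rewrite big_ord0 /= diracE; case: (boolP (_ \in _)) => //.
  by move=> /negP; rewrite inE /=; case; case.
rewrite big_ord_recl -IHn//= /lebesgue_cons /pushforward -product_measure1E//.
- congr (product_measure1 _ _ _); apply/seteqP; split => -[a y] /=.
    move=> Ay; split=> [|i]; first by have := Ay ord0; rewrite cons_rV0.
    by have := Ay (lift ord0 i); rewrite cons_rVS.
  move=> [Aa Ay] i; have [j ->|->] := unliftP ord0 i.
    by rewrite cons_rVS; exact: Ay.
  by rewrite cons_rV0.
- exact: mA.
- rewrite [X in measurable X](_ : _ = \big[setI/setT]_(i < n)
      ((fun x : 'rV[R]_n => x ord0 i) @^-1` A (lift ord0 i))).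
    apply: bigsetI_measurable => i _; rewrite -[X in measurable X]setTI.
    exact: measurable_coord.
  rewrite -bigcap_seq; apply/seteqP; split => [x Ax i _|x Ax i]; first exact: Ax.
  by apply: (Ax i); rewrite /= mem_index_enum.
Qed.

Section nonlocal.
Context {R : realType} {n : nat}.
Implicit Types (w eta phi : 'rV[R]_n -> R) (x y : 'rV[R]_n).

(* The canonical norm of 'rV[R]_n is the sup norm, hence this definition. *)
Definition enorm x : R := Num.sqrt (\sum_(i < n) x ord0 i ^+ 2).

Definition grad w x : 'rV[R]_n := \row_i 'D_(delta_mx ord0 i) w x.

(* 'D_ is total, so this is meaningful only where grad w is differentiable:
   almost everywhere if w is C^{1,1}, by Rademacher's theorem. *)
Definition hessian w x : 'M[R]_n :=
  \matrix_(i, j) 'D_(delta_mx ord0 i) (fun z => grad w z ord0 j) x.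

Definition C11_on (U : set 'rV[R]_n) w : Prop :=
  (forall x, U x -> differentiable w x) /\
  exists C : R, forall x y, U x -> U y ->
    enorm (grad w x - grad w y) <= C * enorm (x - y).

Definition vanishes_at_infinity w : Prop :=
  forall e : R, 0 < e -> exists M : R, forall x, M < enorm x -> `|w x| < e.

Definition delta w x y : R := w (x + y) + w (x - y) - 2 * w x.

(* At y = 0 the integrand is 0, as _^-1 is total. The integral is \bar R-valued
   because that of a test function, which is arbitrary on an open set U, may
   diverge; for the test functions of a subsolution (supersolution), the
   negative (positive) part always has a finite integral. *)
Definition nonlocal_op (F : R -> R) (sigma : R) w x : \bar R :=
  (\int[lebesgue_rV n]_y
    (F (delta w x y) / enorm y `^ (n%:R + sigma))%:E)%E.

Definition weighted_L1 (sigma : R) w : Prop :=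
  (lebesgue_rV n).-integrable setT
    (fun y => (w y / (1 + enorm y) `^ (n%:R + sigma))%:E).

(* patch w U eta is eta on U and w outside U. The right-hand side f may be any
   function: g x (w x - phi x) need not be continuous in x, since g is only
   assumed monotone in its second argument. *)
Definition viscosity_subsolution (F : R -> R) (sigma : R)
    (Omega : set 'rV[R]_n) (f w : 'rV[R]_n -> R) : Prop :=
  [/\ lower_semicontinuous (fun x => (- w x)%:E),
      weighted_L1 sigma w &
      forall x (U : set 'rV[R]_n) eta,
        Omega x -> open U -> U x -> C11_on U eta ->
        eta x = w x -> (forall z, U z -> w z <= eta z) ->
        ((f x)%:E <= nonlocal_op F sigma (patch w U eta) x)%E].

Definition viscosity_supersolution (F : R -> R) (sigma : R)
    (Omega : set 'rV[R]_n) (f w : 'rV[R]_n -> R) : Prop :=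
  [/\ lower_semicontinuous (fun x => (w x)%:E),
      weighted_L1 sigma w &
      forall x (U : set 'rV[R]_n) eta,
        Omega x -> open U -> U x -> C11_on U eta ->
        eta x = w x -> (forall z, U z -> eta z <= w z) ->
        (nonlocal_op F sigma (patch w U eta) x <= (f x)%:E)%E].

End nonlocal.

(* The least Lipschitz constant of f for the distance d. *)
Definition lip_const {R : realType} {T : Type} (d : T -> T -> R) (f : T -> R) :
    \bar R :=
  ereal_sup [set (`|f p.1 - f p.2| / d p.1 p.2)%:E
            | p in [set p : T * T | p.1 <> p.2]].

(* Main.v *)
Require Import Defs.
From HB Require Import structures.
From mathcomp Require Import all_boot all_order all_algebra.
From mathcomp Require Import all_classical all_reals all_analysis.

From mathcomp Require Import ring lra measurable_realfun.

Set Implicit Arguments.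
Unset Strict Implicit.
Unset Printing Implicit Defensive.

Import Order.TTheory GRing.Theory Num.Theory.
Import numFieldNormedType.Exports.

Local Open Scope classical_set_scope.
Local Open Scope ring_scope.

(** The proof doubles the variables and tests the two equations with
paraboloids; the functions [u] and [v] need not be regularized.

Suppose that [u - v] is positive somewhere, and let [M > 0] be its value
there. Since [u - phi] and [v - phi] vanish at infinity and [phi] is
Lipschitz, for [c] large the function [u x - v y - c |x - y|^2] attains its
maximum at some [(a, b)] with [|a - b|] as small as desired and
[M <= u a - v b] ([doubling_max]). Freezing one variable, a convex paraboloid
touches [u] from above at [a], and a concave one touches [v] from below at
[b]. Both are smooth, so they are test functions on balls of any radius [r].

The two resulting nonlocal integrals are compared pointwise. At a distance at
least [r], moving [a] and [b] by the same vector leaves [x - y] unchanged, so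
the maximality of [(a, b)] gives [delta u a y <= delta v b y], and [F] is
increasing. At a distance less than [r] the second differences are
[+- 2 c |y|^2], so both integrands are [O(|y|^(2 - n - sigma))], which
integrates to [O(r^(2 - sigma))] over the ball because [sigma < 2]
([integral_kernel_in]). Subtracting the integrals is legitimate since they
converge at infinity: [delta u a y] grows at most linearly, as [u] is within a
bounded distance of a Lipschitz function, and [|y|^(1 - n - sigma)] is
integrable at infinity because [sigma > 1] ([integral_kernel_out]). This is
[nonlocal_op_doubling_le]. Letting [r] tend to [0],
[g a (u a - phi a) <= g b (v b - phi b)].

On the other hand [(u a - phi a) - (v b - phi b) >= M - L4 |a - b| >= M / 2],
so the strict monotonicity of [g] in its second argument and its Lipschitz
continuity in the first give
[g a (u a - phi a) - g b (v b - phi b) >= mu M / 2 - L2 |a - b| > 0],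
a contradiction. *)

(** * The Euclidean norm and paraboloids *)

Section enorm_theory.
Context {R : realType} {n : nat}.
Implicit Types x y z : 'rV[R]_n.

Lemma enorm_ge0 x : 0 <= enorm x. Proof. exact: sqrtr_ge0. Qed.

Lemma sqr_enorm x : enorm x ^+ 2 = \sum_(i < n) x ord0 i ^+ 2.
Proof. by rewrite sqr_sqrtr// sumr_ge0// => i _; rewrite sqr_ge0. Qed.

Lemma enorm0 : enorm (0 : 'rV[R]_n) = 0.
Proof. by rewrite /enorm big1 ?sqrtr0// => i _; rewrite mxE expr0n. Qed.

Lemma enormZ (a : R) x : enorm (a *: x) = `|a| * enorm x.
Proof.
rewrite /enorm -sqrtr_sqr -sqrtrM ?sqr_ge0// mulr_sumr.
by congr Num.sqrt; apply: eq_bigr => i _; rewrite mxE exprMn.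
Qed.

Lemma enormN x : enorm (- x) = enorm x.
Proof. by rewrite -scaleN1r enormZ normrN1 mul1r. Qed.

Lemma enorm_distC x y : enorm (x - y) = enorm (y - x).
Proof. by rewrite -enormN opprB. Qed.

(** The balls, the compactness and the dyadic estimates below are those of the
sup norm, whose balls are cubes; this inequality carries them over to the
Euclidean norm of the kernel. *)
Lemma mx_norm_le_enorm x : `|x| <= enorm x.
Proof.
rewrite [leLHS]/Num.Def.normr/= mx_normrE; apply/bigmax_leP; split=> [|[i j] _ /=].
  exact: enorm_ge0.
rewrite -sqrtr_sqr (ord1 i) ler_wsqrtr// (bigD1 j)//= lerDl.
by rewrite sumr_ge0// => k _; rewrite sqr_ge0.
Qed.

Lemma enorm_gt0 x : x != 0 -> 0 < enorm x.
Proof. by move=> x0; rewrite (lt_le_trans _ (mx_norm_le_enorm x))// normr_gt0. Qed.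

Lemma is_derive_coord x v i :
  is_derive x v (fun z : 'rV[R]_n => z ord0 i) (v ord0 i).
Proof.
have dc : differentiable (fun z : 'rV[R]_n => z ord0 i) x.
  exact: differentiable_coord.
apply: DeriveDef; first exact: diff_derivable.
rewrite deriveE//.
have lc : linear (fun z : 'rV[R]_n => z ord0 i : R^o).
  by move=> a y z; rewrite !mxE.
pose L : {linear 'rV[R]_n -> R^o} := HB.pack (fun z : 'rV[R]_n => z ord0 i : R^o)
  (GRing.isLinear.Build _ _ _ _ (fun z : 'rV[R]_n => z ord0 i : R^o) lc).
by rewrite (@diff_lin _ _ _ L)//; exact: coord_continuous.
Qed.

Definition paraboloid (k c : R) (b : 'rV[R]_n) z : R := k + c * enorm (z - b) ^+ 2.

Lemma paraboloidE k c b : paraboloid k c b =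
  cst k + c *: \sum_(i < n) (fun z : 'rV[R]_n => z ord0 i - b ord0 i) ^+ 2.
Proof.
apply/funext => z; rewrite /paraboloid sqr_enorm; congr (_ + _ * _).
by rewrite fct_sumE; apply: eq_bigr => i _; rewrite !mxE.
Qed.

Lemma differentiable_paraboloid k c b x : differentiable (paraboloid k c b) x.
Proof.
rewrite paraboloidE; apply: differentiableD => //.
apply: differentiableZ; apply: differentiable_sum => i.
apply: differentiableX; apply: differentiableB => //.
exact: differentiable_coord.
Qed.

Lemma continuous_paraboloid k c b : continuous (paraboloid k c b).
Proof. by move=> x; exact/differentiable_continuous/differentiable_paraboloid. Qed.

Lemma continuous_enorm : continuous (enorm : 'rV[R]_n -> R).
Proof.
have -> : enorm = Num.sqrt \o paraboloid 0 1 0 :> ('rV[R]_n -> R).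
  apply/funext => x /=; rewrite /paraboloid add0r mul1r subr0.
  by rewrite sqrtr_sqr ger0_norm// enorm_ge0.
move=> x; apply: continuous_comp; first exact: continuous_paraboloid.
exact: sqrt_continuous.
Qed.

Lemma grad_paraboloid k c b x : grad (paraboloid k c b) x = (2 * c) *: (x - b).
Proof.
apply/rowP => i; rewrite !mxE paraboloidE.
pose q (j : 'I_n) (z : 'rV[R]_n) : R := z ord0 j - b ord0 j.
have dq j : is_derive x (delta_mx ord0 i) (q j) ((i == j)%:R - 0).
  have := is_derive_coord x (delta_mx ord0 i) j.
  rewrite mxE eqxx/= eq_sym => dc; exact: is_deriveB.
have dqX j : is_derive x (delta_mx ord0 i) (q j ^+ 2)
    ((2%:R * q j x ^+ 1) *: ((i == j)%:R - 0)) by exact: is_deriveX.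
have dqS := is_derive_sum dqX.
have dP := is_deriveD (is_derive_cst k x (delta_mx ord0 i)) (is_deriveZ c dqS).
rewrite [LHS](@derive_val _ _ _ _ _ _ _ dP) add0r (bigD1 i)//= big1 => [|j ji].
  by rewrite eqxx subr0 addr0 expr1 /q /GRing.scale/= mulr1 mulrA (mulrC c).
by rewrite eq_sym (negbTE ji) subr0 scaler0.
Qed.

Lemma C11_paraboloid U k c b : C11_on U (paraboloid k c b).
Proof.
split=> [x _|]; first exact: differentiable_paraboloid.
exists `|2 * c| => x y _ _; rewrite !grad_paraboloid -scalerBr enormZ.
by rewrite (_ : x - b - (y - b) = x - y)// opprB addrA subrK.
Qed.

(** The parallelogram identity: the second difference of a quadratic function
is the same at every base point. *)
Lemma delta_paraboloid k c b x y :
  delta (paraboloid k c b) x y = 2 * c * enorm y ^+ 2.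
Proof.
rewrite /delta /paraboloid; apply/eqP; rewrite -subr_eq0; apply/eqP.
have -> : enorm (x + y - b) ^+ 2 =
    2 * enorm (x - b) ^+ 2 + 2 * enorm y ^+ 2 - enorm (x - y - b) ^+ 2.
  rewrite !sqr_enorm !mulr_sumr -big_split/= -sumrB; apply: eq_bigr => i _.
  by rewrite !mxE; ring.
by ring.
Qed.

End enorm_theory.

(** * Continuous functions are measurable for the product sigma-algebra *)

Section measurability.
Context {R : realType} {n : nat}.
Implicit Types x y z : 'rV[R]_n.

Lemma ball_rVE x (e : R) : 0 < e ->
  ball x e = [set y : 'rV[R]_n | forall i, ball (x ord0 i) e (y ord0 i)].
Proof.
move=> e0; apply/seteqP; split=> y.
  by move=> [_ xy] i; exact: xy.
by move=> xy; split=> // i j; rewrite (ord1 i); exact: xy.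
Qed.

Lemma measurable_ball_rV x (e : R) : measurable (ball x e : set 'rV[R]_n).
Proof.
have [e0|e0] := ltP 0 e; last first.
  rewrite (_ : ball x e = set0)//; apply/seteqP; split=> // y [e_gt0 _].
  by rewrite ltNge e0 in e_gt0.
rewrite ball_rVE// [X in measurable X](_ : _ = \bigcap_(i in [set` finset.setT])
    ((fun y : 'rV[R]_n => y ord0 i) @^-1` ball (x ord0 i) e)).
  apply: fin_bigcap_measurable => [|i _]; first exact: finite_finset.
  rewrite -[X in measurable X]setTI.
  by apply: measurable_coord => //; exact: measurable_ball.
by apply/seteqP; split => y /= xy i; [move=> _|]; apply: xy; rewrite /= ?inE.
Qed.

(** The sigma-algebra is generated by the coordinates. An open set is the union
of the countably many balls with rational centre and radius [1 / k.+1] that it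
contains, and each of these balls is a finite intersection of slabs. *)
Lemma open_measurable_rV (U : set 'rV[R]_n) : open U -> measurable U.
Proof.
move=> oU.
pose q (p : 'rV[rat]_n) : 'rV[R]_n := map_mx ratr p.
pose B (pk : 'rV[rat]_n * nat) : set 'rV[R]_n :=
  if `[< ball (q pk.1) pk.2.+1%:R^-1 `<=` U >] then ball (q pk.1) pk.2.+1%:R^-1
  else set0.
have -> : U = \bigcup_pk B pk.
  apply/seteqP; split=> [x Ux|x [pk _]]; last first.
    by rewrite /B; case: asboolP => // sU /sU.
  have /nbhs_ballP[e /= e0 xeU] : nbhs x U by apply: open_nbhs_nbhs; split.
  have [k ke] : exists k : nat, k.+1%:R^-1 < e / 2.
    have [k _ /(_ k (leqnn k)) ke] := near_infty_natSinv_lt (PosNum (divr_gt0 e0 (ltr0n _ 2))).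
    by exists k.
  have k0 : 0 < k.+1%:R^-1 :> R by rewrite invr_gt0.
  have /choice[p pP] : forall i : 'I_n, exists p : rat,
      ball (x ord0 i) k.+1%:R^-1 (ratr p).
    move=> i; have /rat_in_itvoo[p] : x ord0 i - k.+1%:R^-1 < x ord0 i + k.+1%:R^-1.
      by rewrite ltrD2l gtrN.
    by move=> xp; exists p; rewrite ball_itv.
  have qx : ball (q (\row_i p i)) k.+1%:R^-1 x.
    by rewrite ball_rVE//= => i; rewrite !mxE; exact/ball_sym.
  exists (\row_i p i, k) => //; rewrite /B asboolT// => y qy.
  apply: xeU; apply: (@le_ball _ _ _ (k.+1%:R^-1 + k.+1%:R^-1)).
    by rewrite [leRHS]splitr lerD// ltW.
  by apply: ball_triangle qy; exact: ball_sym.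
apply: countable_bigcupT_measurable => [|pk]; first exact: countableP.
by rewrite /B; case: ifP => // _; exact: measurable_ball_rV.
Qed.

Lemma continuous_measurable_rV (f : 'rV[R]_n -> R) :
  continuous f -> measurable_fun [set: 'rV[R]_n] f.
Proof.
move=> /continuousP cf.
apply: (measurability _ (RGenOpens.measurableE R)) => _ [_ [a [b ->] <-]].
by rewrite setTI; apply: open_measurable_rV; exact/cf/interval_open.
Qed.

End measurability.

(** * Integrals of power kernels *)

Section kernel_integrals.
Context {R : realType} {n : nat}.
Implicit Types (y : 'rV[R]_n) (p r e z : R).

Lemma ball0_rVE r : ball (0 : 'rV[R]_n) r = [set y | `|y| < r].
Proof.
by apply/seteqP; split=> y; rewrite mx_norm_ball /ball_ /= sub0r normrN.
Qed.

Lemma lebesgue_rV_ball e : 0 < e ->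
  lebesgue_rV n (ball (0 : 'rV[R]_n) e) = ((2 * e) ^+ n)%:E.
Proof.
move=> e0; rewrite ball_rVE//.
rewrite [X in lebesgue_rV n X](_ : _ =
    [set y : 'rV[R]_n | forall i, ball (0 : R) e (y ord0 i)]); last first.
  by apply/seteqP; split=> y /= h i; have := h i; rewrite mxE.
rewrite (@lebesgue_rV_box R n (fun=> ball (0 : R) e)) => [|i]; last first.
  exact: measurable_ball.
rewrite (eq_bigr (fun=> (2 * e)%:E)) => [|i _].
  by rewrite prodEFin prodr_const card_ord.
by rewrite lebesgue_measure_ball ?(ltW e0)// mulr2n mulrDl mul1r.
Qed.

(** The integral is estimated over dyadic shells. On the shell
[r z^k <= |y| < 2 r z^k] the function is at most [(r z^k)^(-p)], and the cube
around this shell has volume [(4 r z^k)^n]; the bounds form a geometric series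
of ratio [z^(n - p)]. The choice [z = 1/2] serves an integrable singularity at
the origin, and [z = 2] an integrable tail. *)
Lemma integral_le_of_shells (f : 'rV[R]_n -> R) p r z :
  0 < p -> 0 < r -> 0 < z -> z `^ (n%:R - p) < 1 ->
  measurable_fun [set: 'rV[R]_n] f -> (forall y, 0 <= f y) ->
  (forall y, f y != 0 ->
    exists k, r * z ^+ k <= `|y| < 2 * (r * z ^+ k) /\ f y <= `|y| `^ (- p)) ->
  (\int[lebesgue_rV n]_y (f y)%:E <=
    (4 ^+ n / (1 - z `^ (n%:R - p)) * r `^ (n%:R - p))%:E)%E.
Proof.
move=> p0 r0 z0 zp1 mf f0 fk.
have rz k : 0 < r * z ^+ k by rewrite mulr_gt0// exprn_gt0.
pose h k y : \bar R := ((r * z ^+ k) `^ (- p) * \1_(ball 0 (2 * (r * z ^+ k))) y)%:E.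
have h0 k y : (0 <= h k y)%E.
  by rewrite lee_fin mulr_ge0 ?powR_ge0// indicE.
have mh k : measurable_fun [set: 'rV[R]_n] (h k).
  apply/measurable_EFinP; apply: measurable_funM => //.
  by apply/measurable_indicP; exact: measurable_ball_rV.
(* The shell containing [y] already contributes at least [f y] to the series. *)
have fh y : ((f y)%:E <= \sum_(0 <= k <oo) h k y)%E.
  have [->|fy0] := eqVneq (f y) 0; first exact: nneseries_ge0.
  have [k [/andP[ry yr] fy]] := fk _ fy0.
  apply: (@le_trans _ _ (h k y)).
    rewrite lee_fin (le_trans fy)// indicE mem_set ?ball0_rVE// mulr1.
    have y0 : 0 < `|y| by exact: lt_le_trans ry.
    by rewrite !powRN lef_pV2 ?posrE ?powR_gt0// ge0_ler_powR ?nnegrE// ltW.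
  apply: le_trans (@nneseries_lim_ge _ (h ^~ y) xpredT 0 k.+1 _) => //.
  rewrite big_nat_recr//= leeDr//.
  by apply: sume_ge0 => // i _; exact: h0.
apply: (@le_trans _ _ (\int[lebesgue_rV n]_y \sum_(0 <= k <oo) h k y)%E).
  apply: ge0_le_integral => //.
  - by move=> y _; rewrite lee_fin.
  - exact/measurable_EFinP.
  - by apply: ge0_emeasurable_sum.
rewrite integral_nneseries//.
have int_h k : (\int[lebesgue_rV n]_y h k y)%E =
    (geometric (4 ^+ n * r `^ (n%:R - p)) (z `^ (n%:R - p)) k)%:E.
  have mI : measurable_fun [set: 'rV[R]_n]
      (fun y => (\1_(ball 0 (2 * (r * z ^+ k))) y)%:E : \bar R).
    by apply/measurable_EFinP/measurable_indicP; exact: measurable_ball_rV.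
  rewrite /h.
  under eq_integral do rewrite EFinM.
  rewrite ge0_integralZl ?lee_fin ?powR_ge0//.
  rewrite integral_indic//; last exact: measurable_ball_rV.
  have rk2 : 0 < 2 * (r * z ^+ k) by rewrite mulr_gt0.
  rewrite setIT; apply: (etrans (congr1 (fun t => _ * t)%E (lebesgue_rV_ball rk2))).
  rewrite -EFinM /geometric/=; congr EFin.
  have rk := rz k; have rk0 := ltW rk.
  rewrite -mulrA.
  have -> : r `^ (n%:R - p) * (z `^ (n%:R - p)) ^+ k = (r * z ^+ k) `^ (n%:R - p) :> R.
    rewrite powRM ?ltW ?exprn_gt0//; congr (_ * _).
    by rewrite -powR_mulrn ?powR_ge0// -powRrM mulrC powRrM powR_mulrn// ltW.
  rewrite powRD ?(gt_eqF rk) ?implybT// powR_mulrn// [LHS]mulrC [RHS]mulrA -exprMn.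
  by congr (_ ^+ _ * _); ring.
rewrite (eq_eseriesr (fun k _ => int_h k)).
have a0 : 0 <= 4 ^+ n * r `^ (n%:R - p) by rewrite mulr_ge0 ?exprn_ge0 ?powR_ge0.
have q0 : 0 < z `^ (n%:R - p) by rewrite powR_gt0.
apply: lime_le.
  by apply: is_cvg_nneseries => k _ _; rewrite lee_fin geometric_ge0// ltW.
apply: nearW => k; rewrite sumEFin lee_fin mulrAC.
have := geometric_le_lim k a0 q0.
by rewrite ger0_norm ?(ltW q0)//; exact.
Qed.

End kernel_integrals.

Lemma dyadic_shell_in {R : realType} (r s : R) : 0 < s < r ->
  exists k, r / 2 * 2^-1 ^+ k <= s < 2 * (r / 2 * 2^-1 ^+ k).
Proof.
move=> /andP[s0 sr].
have [K rK] : exists k, r / 2 * 2^-1 ^+ k <= s.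
  exists (Num.bound (r / s)); have := archi_boundP (divr_ge0 (ltW (lt_trans s0 sr)) (ltW s0)).
  set k := Num.bound _; rewrite ltr_pdivrMr// => rk.
  rewrite exprVn ler_pdivrMr ?exprn_gt0//.
  have : k%:R <= 2 ^+ k :> R by rewrite -natrX ler_nat ltnW// ltn_expl.
  by move=> /(ler_wpM2l (ltW s0)); lra.
case: (ex_minnP (ex_intro (fun k => r / 2 * 2^-1 ^+ k <= s) K rK)) => k ks kmin.
exists k; rewrite ks/=.
case: k => [|k] in ks kmin *; first by rewrite expr0; lra.
rewrite ltNge; apply/negP => h.
suff /kmin : r / 2 * 2^-1 ^+ k <= s by rewrite ltnn.
by apply: le_trans h; rewrite exprS; lra.
Qed.

Lemma dyadic_shell_out {R : realType} (r s : R) : 0 < r <= s ->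
  exists k, r * 2 ^+ k <= s < 2 * (r * 2 ^+ k).
Proof.
move=> /andP[r0 rs].
have [K rK] : exists k, s < 2 * (r * 2 ^+ k).
  exists (Num.bound (s / r)); have := archi_boundP (divr_ge0 (le_trans (ltW r0) rs) (ltW r0)).
  set k := Num.bound _; rewrite ltr_pdivrMr// => rk.
  have : k%:R <= 2 ^+ k :> R by rewrite -natrX ler_nat ltnW// ltn_expl.
  have : 0 <= r * 2 ^+ k by rewrite mulr_ge0 ?exprn_ge0// ltW.
  by move=> ? /(ler_wpM2l (ltW r0)); lra.
case: (ex_minnP (ex_intro (fun k => s < 2 * (r * 2 ^+ k)) K rK)) => k ks kmin.
exists k; rewrite ks andbT.
case: k => [|k] in ks kmin *; first by rewrite expr0; lra.
rewrite leNgt; apply/negP => h.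
suff /kmin : s < 2 * (r * 2 ^+ k) by rewrite ltnn.
by apply: lt_le_trans h _; rewrite exprS; lra.
Qed.

Section kernel.
Context {R : realType} {n : nat} {sigma : R}.
Context (sigma1 : 1 < sigma) (sigma2 : sigma < 2) (n0 : (0 < n)%N).
Implicit Types (y : 'rV[R]_n) (r : R).

Let N : R := n%:R + sigma.

Let N_gt2 : 2 < N.
Proof. by rewrite /N (_ : 2 = 1 + 1 :> R)// ler_ltD// ler1n. Qed.

(** The two majorants of the integrands: second differences are quadratic in
[y] near the origin, where the test function is smooth, and at most linear far
away. Both kernels vanish at [y = 0], as does the integrand of
[nonlocal_op]. *)
Definition kernel_in r y : R :=
  \1_(ball (0 : 'rV[R]_n) r) y * (enorm y ^+ 2 / enorm y `^ N).

Definition kernel_out r y : R :=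
  \1_(~` ball (0 : 'rV[R]_n) r) y * (enorm y / enorm y `^ N).

Lemma measurable_enorm_powN q : measurable_fun [set: 'rV[R]_n]
  (fun y => enorm y ^+ q / enorm y `^ N).
Proof.
have me := continuous_measurable_rV (@continuous_enorm R n).
under eq_fun do rewrite -powRN.
apply: measurable_funM; first exact: measurable_funX.
exact: (measurableT_comp (measurable_powR _) me).
Qed.

Lemma enorm_powN_le q y : q%:R < N -> y != 0 ->
  enorm y ^+ q / enorm y `^ N <= `|y| `^ (- (N - q%:R)).
Proof.
move=> qN y0; have e0 := enorm_gt0 y0; have y_gt0 : 0 < `|y| by rewrite normr_gt0.
rewrite -powR_mulrn ?(ltW e0)// -powRN -powRD ?(gt_eqF e0) ?implybT//.
rewrite -[q%:R - N]opprB !powRN lef_pV2 ?posrE ?powR_gt0//.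
by rewrite ge0_ler_powR ?nnegrE ?enorm_ge0 ?mx_norm_le_enorm// ltW// subr_gt0.
Qed.

Lemma measurable_kernel_in r : measurable_fun [set: 'rV[R]_n] (kernel_in r).
Proof.
apply: measurable_funM (measurable_enorm_powN 2).
by apply/measurable_indicP; exact: measurable_ball_rV.
Qed.

Lemma measurable_kernel_out r : measurable_fun [set: 'rV[R]_n] (kernel_out r).
Proof.
apply: measurable_funM (measurable_enorm_powN 1).
by apply/measurable_indicP/measurableC; exact: measurable_ball_rV.
Qed.

Lemma kernel_in_ge0 r y : 0 <= kernel_in r y.
Proof. by rewrite mulr_ge0 ?divr_ge0 ?powR_ge0 ?exprn_ge0 ?enorm_ge0// indicE. Qed.

Lemma kernel_out_ge0 r y : 0 <= kernel_out r y.
Proof. by rewrite mulr_ge0 ?divr_ge0 ?powR_ge0 ?enorm_ge0// indicE. Qed.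

(** The exponent [p = n + sigma - 2] satisfies [n - p = 2 - sigma > 0]. *)
Lemma integral_kernel_in : exists2 C : R, 0 <= C & forall r, 0 < r ->
  (\int[lebesgue_rV n]_y (kernel_in r y)%:E <= (C * r `^ (2 - sigma))%:E)%E.
Proof.
have NE : n%:R - (N - 2) = 2 - sigma by rewrite /N; ring.
have z1 : 2^-1 `^ (2 - sigma) < 1 :> R.
  have s0 : 0 < 2 - sigma by rewrite subr_gt0.
  by have := @gt0_ltr_powR R _ s0 2^-1 1; rewrite powR1 !nnegrE; apply; lra.
(* The shells start at radius [r / 2], whence the last factor. *)
exists (4 ^+ n / (1 - 2^-1 `^ (2 - sigma)) * 2^-1 `^ (2 - sigma)).
  by rewrite mulr_ge0 ?divr_ge0 ?exprn_ge0 ?powR_ge0// subr_ge0 ltW.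
move=> r r0.
have -> : 4 ^+ n / (1 - 2^-1 `^ (2 - sigma)) * 2^-1 `^ (2 - sigma) *
    r `^ (2 - sigma) =
    4 ^+ n / (1 - 2^-1 `^ (n%:R - (N - 2))) * (r / 2) `^ (n%:R - (N - 2)).
  by rewrite NE powRM ?(ltW r0)// -mulrA [_ * r `^ _]mulrC.
apply: integral_le_of_shells; rewrite ?NE ?divr_gt0//.
- by rewrite subr_gt0.
- exact: measurable_kernel_in.
- exact: kernel_in_ge0.
move=> y; rewrite /kernel_in indicE ball0_rVE; case: (boolP (y \in _)); last first.
  by rewrite mul0r eqxx.
rewrite inE/= mul1r => yr.
have [->|y0 _] := eqVneq y 0; first by rewrite enorm0 expr0n mul0r eqxx.
have [k hk] : exists k, r / 2 * 2^-1 ^+ k <= `|y| < 2 * (r / 2 * 2^-1 ^+ k).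
  by apply: dyadic_shell_in; rewrite normr_gt0 y0.
by exists k; split=> //; exact: enorm_powN_le.
Qed.

(** The exponent [p = n + sigma - 1] satisfies [n - p = 1 - sigma < 0]. *)
Lemma integral_kernel_out r : 0 < r ->
  (\int[lebesgue_rV n]_y (kernel_out r y)%:E < +oo)%E.
Proof.
move=> r0; have NE : n%:R - (N - 1) = 1 - sigma by rewrite /N; ring.
have z1 : 2 `^ (1 - sigma) < 1 :> R.
  rewrite -opprB powRN invf_lt1 ?powR_gt0//.
  have s0 : 0 < sigma - 1 by rewrite subr_gt0.
  by have := @gt0_ltr_powR R _ s0 1 2; rewrite powR1 !nnegrE; apply; lra.
apply: (@le_lt_trans _ _ (4 ^+ n / (1 - 2 `^ (n%:R - (N - 1))) *
   r `^ (n%:R - (N - 1)))%:E); last by rewrite ltry.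
apply: integral_le_of_shells; rewrite ?NE//.
- by have := N_gt2; lra.
- exact: measurable_kernel_out.
- exact: kernel_out_ge0.
move=> y; rewrite /kernel_out indicE ball0_rVE; case: (boolP (y \in _)); last first.
  by rewrite mul0r eqxx.
rewrite inE/= mul1r => /negP; rewrite -leNgt => yr _.
have y0 : y != 0 by rewrite -normr_gt0 (lt_le_trans r0).
have [k hk] : exists k, r * 2 ^+ k <= `|y| < 2 * (r * 2 ^+ k).
  by apply: dyadic_shell_out; rewrite r0.
exists k; split=> //; rewrite -[X in X / _]expr1.
by apply: enorm_powN_le => //; have := N_gt2; lra.
Qed.

Lemma integrable_kernel_in r : 0 < r ->
  (lebesgue_rV n).-integrable setT (fun y => (kernel_in r y)%:E).
Proof.
move=> r0; apply/integrableP; split.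
  by apply/measurable_EFinP; exact: measurable_kernel_in.
have [C C0 /(_ _ r0) hC] := integral_kernel_in.
under eq_integral do rewrite gee0_abs ?lee_fin ?kernel_in_ge0//.
by rewrite (le_lt_trans hC)// ltry.
Qed.

Lemma integrable_kernel_out r : 0 < r ->
  (lebesgue_rV n).-integrable setT (fun y => (kernel_out r y)%:E).
Proof.
move=> r0; apply/integrableP; split.
  by apply/measurable_EFinP; exact: measurable_kernel_out.
under eq_integral do rewrite gee0_abs ?lee_fin ?kernel_out_ge0//.
exact: integral_kernel_out.
Qed.

Lemma integrable_of_growth (h : 'rV[R]_n -> R) (A B r : R) : 0 < r ->
  measurable_fun [set: 'rV[R]_n] h ->
  (forall y, `|y| < r -> `|h y| <= A * enorm y ^+ 2) ->
  (forall y, r <= `|y| -> `|h y| <= B * enorm y) ->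
  (lebesgue_rV n).-integrable setT (fun y => (h y / enorm y `^ N)%:E).
Proof.
move=> r0 mh hA hB.
apply: (@le_integrable _ _ _ _ _ measurableT _
  (fun y => A%:E * (kernel_in r y)%:E + B%:E * (kernel_out r y)%:E)%E).
- apply/measurable_EFinP; apply: measurable_funM => //.
  have := measurable_enorm_powN 0; under eq_fun do rewrite expr0 mul1r.
  by [].
- move=> y _; rewrite -!EFinM -EFinD lee_fin.
  rewrite normrM [`|_^-1|]ger0_norm ?invr_ge0 ?powR_ge0//.
  apply: le_trans (ler_norm _).
  rewrite /kernel_in /kernel_out !indicE in_setC ball0_rVE.
  have [yr|ry] := ltP (`|y|) r.
    rewrite mem_set//= mul0r mul1r mulr0 addr0 mulrA.
    by rewrite ler_wpM2r ?invr_ge0 ?powR_ge0// hA.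
  rewrite memNset//=; last by apply/negP; rewrite -leNgt.
  rewrite mul0r mul1r mulr0 add0r mulrA.
  by rewrite ler_wpM2r ?invr_ge0 ?powR_ge0// hB.
- by apply: integrableD => //; apply: integrableZl => //;
    [exact: integrable_kernel_in|exact: integrable_kernel_out].
Qed.

(** Integrability of both sides is what allows the pointwise inequality
[h1 <= h2 + 2 A |y|^2 1_(|y| < r)] to be integrated term by term. *)
Lemma le_integral_kernel (h1 h2 : 'rV[R]_n -> R) (A B r : R) : 0 < r ->
  measurable_fun [set: 'rV[R]_n] h1 -> measurable_fun [set: 'rV[R]_n] h2 ->
  (forall y, `|y| < r -> `|h1 y| <= A * enorm y ^+ 2) ->
  (forall y, `|y| < r -> `|h2 y| <= A * enorm y ^+ 2) ->
  (forall y, r <= `|y| -> `|h1 y| <= B * enorm y) ->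
  (forall y, r <= `|y| -> `|h2 y| <= B * enorm y) ->
  (forall y, r <= `|y| -> h1 y <= h2 y) ->
  (\int[lebesgue_rV n]_y (h1 y / enorm y `^ N)%:E <=
   \int[lebesgue_rV n]_y (h2 y / enorm y `^ N)%:E +
   (2 * A)%:E * \int[lebesgue_rV n]_y (kernel_in r y)%:E)%E.
Proof.
move=> r0 mh1 mh2 h1A h2A h1B h2B h12.
have i1 := integrable_of_growth r0 mh1 h1A h1B.
have i2 := integrable_of_growth r0 mh2 h2A h2B.
have ik := integrable_kernel_in r0.
rewrite -integralZl// -integralD//; last exact: integrableZl.
apply: le_integral => //; first by apply: integrableD => //; exact: integrableZl.
move=> y _; rewrite -EFinM -EFinD lee_fin /kernel_in indicE ball0_rVE.
have [yr|ry] := ltP (`|y|) r.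
  rewrite mem_set//= mul1r mulrA -mulrDl ler_wpM2r ?invr_ge0 ?powR_ge0//.
  have := h1A _ yr; have := h2A _ yr; rewrite !ler_norml => /andP[+ _] /andP[_].
  lra.
rewrite memNset//=; last by apply/negP; rewrite -leNgt.
by rewrite mul0r mulr0 addr0 ler_wpM2r ?invr_ge0 ?powR_ge0// h12.
Qed.

End kernel.

(** * Elementary consequences of the hypotheses on F and phi *)

Section lipschitz_bounds.
Context {R : realType}.

Lemma lip_const_le {T : Type} (d : T -> T -> R) (f : T -> R) (L : R) x y :
  (lip_const d f <= L%:E)%E -> x <> y -> 0 < d x y ->
  `|f x - f y| <= L * d x y.
Proof.
move=> fL xy dxy; rewrite -ler_pdivrMr// -lee_fin; apply: le_trans fL.
by apply: ereal_sup_ubound; exists (x, y).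
Qed.

(** The absolute value of [L] spares the proof that a Lipschitz constant is
nonnegative, which would require two distinct points. *)
Lemma lip_const_enorm_le {n} (f : 'rV[R]_n -> R) (L : R) x y :
  (lip_const (fun x y : 'rV[R]_n => enorm (x - y)) f <= L%:E)%E ->
  `|f x - f y| <= `|L| * enorm (x - y).
Proof.
move=> fL; have [->|/eqP xy] := eqVneq x y.
  by rewrite subrr normr0 mulr_ge0// enorm_ge0.
have e0 : 0 < enorm (x - y) by apply: enorm_gt0; rewrite subr_eq0; exact/eqP.
by apply: le_trans (lip_const_le fL xy e0) _; rewrite ler_wpM2r ?enorm_ge0// ler_norm.
Qed.

Lemma derive1_gt0_homo (F : R -> R) : (forall t, derivable F t 1) ->
  (forall t, 0 < derive1 F t) -> {homo F : s t / s <= t}.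
Proof.
move=> dF F'0 s t; rewrite le_eqVlt => /predU1P[->//|st].
apply/ltW/(@gtr0_derive1_incr _ F s t) => //.
by apply: derivable_within_continuous => z _.
Qed.

Lemma le_of_le_powR (a b K s : R) : 0 <= K -> 0 < s ->
  (forall r, 0 < r -> a <= b + K * r `^ s) -> a <= b.
Proof.
move=> K0 s0 h; rewrite leNgt; apply/negP => ba.
(* [r] is chosen such that [K r^s = K (a - b) / (K + 1) < a - b]. *)
have d0 : 0 < (a - b) / (K + 1) by rewrite divr_gt0 ?subr_gt0// ltr_wpDl.
have := h (((a - b) / (K + 1)) `^ s^-1); rewrite powR_gt0// => /(_ isT).
rewrite -powRrM mulVf ?gt_eqF// powRr1 ?(ltW d0)// mulrA -lerBlDl.
rewrite ler_pdivlMr ?ltr_wpDl// mulrC ler_pM2r ?subr_gt0//.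
by rewrite gerDl ler10.
Qed.

End lipschitz_bounds.

(** * Doubling of variables *)

Section doubling.
Context {R : realType} {n : nat}.
Implicit Types (x y : 'rV[R]_n) (w phi u v : 'rV[R]_n -> R).

Lemma compact_le_mx_norm (rho : R) : compact [set x : 'rV[R]_n | `|x| <= rho].
Proof.
apply: bounded_closed_compact.
  by exists rho; split=> [|s rs x /= xr]; [exact: num_real|exact: le_trans xr (ltW rs)].
rewrite (_ : [set x | _] = closed_ball_ (fun x : 'rV[R]_n => `|x|) 0 rho).
  exact: closed_closed_ball_.
by apply/seteqP; split=> x; rewrite /closed_ball_/= sub0r normrN.
Qed.

Lemma vanishing_bounded w : continuous w -> vanishes_at_infinity w ->
  exists2 B, 0 <= B & forall x, `|w x| <= B.
Proof.
move=> cw w0; have [M wM] := w0 1 ltr01.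
pose D := [set x : 'rV[R]_n | `|x| <= `|M|].
have cD : compact D by exact: compact_le_mx_norm.
have D0 : D !=set0 by exists 0; rewrite /D/= normr0.
have cnw : {within D, continuous (fun x => `|w x|)}.
  apply: continuous_subspaceT => x.
  by apply: continuous_comp (cw x) _; exact: norm_continuous.
have [z _ zmax] := EVT_max_rV D0 cD cnw.
exists (`|w z| + 1); first by rewrite addr_ge0.
move=> x; have [xM|Mx] := leP (`|x|) `|M|.
  by rewrite (le_trans (zmax x _))//; [rewrite inE|rewrite lerDl].
rewrite (le_trans (ltW (wM x _)))//; last by rewrite lerDr.
by rewrite (le_lt_trans (ler_norm M))// (lt_le_trans Mx)// mx_norm_le_enorm.
Qed.

(** [w] itself may be unbounded; its second difference differs by a bounded
amount from that of the Lipschitz function [phi]. *)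
Lemma delta_le_growth w phi (B L : R) x y :
  (forall z, `|w z - phi z| <= B) ->
  (forall z z', `|phi z - phi z'| <= L * enorm (z - z')) ->
  `|delta w x y| <= 4 * B + 2 * L * enorm y.
Proof.
move=> wB phiL; rewrite /delta.
have := wB (x + y); have := wB (x - y); have := wB x.
have := phiL (x + y) x; have := phiL (x - y) x.
rewrite [x + y]addrC addrK [x - y]addrC addrK enormN !ler_norml => /andP[? ?].
by move=> /andP[? ?] /andP[? ?] /andP[? ?] /andP[? ?]; lra.
Qed.

Lemma delta_patch_ball w eta x y (r : R) : 0 < r -> eta x = w x ->
  delta (patch w (ball x r) eta) x y =
  if `|y| < r then delta eta x y else delta w x y.
Proof.
move=> r0 etax.
have patchE z : patch w (ball x r) eta (x + z) =
    if `|z| < r then eta (x + z) else w (x + z).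
  rewrite /patch mx_norm_ball /ball_; case: ifPn.
    by rewrite inE/= opprD addrA subrr sub0r normrN => ->.
  by rewrite notin_setE/= opprD addrA subrr sub0r normrN => /negP/negbTE ->.
have patchx := patchE 0; rewrite normr0 r0 addr0 in patchx.
rewrite /delta patchx !patchE normrN.
by case: ifP => // _; rewrite etax.
Qed.

(** Write [u x - v y] as [(u - phi) x - (v - phi) y + (phi x - phi y)], where
the last term is at most [L |x - y|]. If [|x - y| >= eta], the quadratic
penalty with a large [c] beats both the bounds of the first two terms and the
linear term, so the penalized function is at most [0]. If [|x - y| < eta] and
[x] or [y] is far from the origin, both are far, the first two terms are each
less than [M / 4], and the last one is at most [L eta <= M / 4]. Outside a
compact set the penalized function is therefore at most [M], its value at
[(x0, x0)]. *)
Lemma doubling_max u v phi (L eta : R) x0 :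
  continuous u -> continuous v -> continuous phi -> 0 <= L ->
  (forall z z', `|phi z - phi z'| <= L * enorm (z - z')) ->
  vanishes_at_infinity (fun x => u x - phi x) ->
  vanishes_at_infinity (fun x => v x - phi x) ->
  0 < eta -> 4 * L * eta <= u x0 - v x0 -> v x0 < u x0 ->
  exists (c : R) a b,
    [/\ 0 < c, enorm (a - b) < eta, u x0 - v x0 <= u a - v b &
      forall x y, u x - v y - c * enorm (x - y) ^+ 2 <=
                  u a - v b - c * enorm (a - b) ^+ 2].
Proof.
move=> cu cv cphi L0 phiL uphi vphi eta0 Leta uv0.
set M := u x0 - v x0 in Leta *.
have M0 : 0 < M by rewrite subr_gt0.
have cuphi : continuous (fun x => u x - phi x) by move=> x; exact: cvgB (cu x) (cphi x).
have cvphi : continuous (fun x => v x - phi x) by move=> x; exact: cvgB (cv x) (cphi x).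
have [Bu Bu0 uB] := vanishing_bounded cuphi uphi.
have [Bv Bv0 vB] := vanishing_bounded cvphi vphi.
have M40 : 0 < M / 4 by rewrite divr_gt0.
have [ru uru] := uphi _ M40.
have [rv vrv] := vphi _ M40.
(* Since [c eta] exceeds [L + (Bu + Bv) / eta], for [t >= eta] one has
   [c t^2 >= c eta t >= L t + (Bu + Bv)]. *)
pose c := (L + (Bu + Bv) / eta + 1) / eta.
have BE0 : 0 <= (Bu + Bv) / eta by rewrite divr_ge0 ?addr_ge0// ltW.
have c0 : 0 < c by rewrite divr_gt0//; lra.
have ceta : c * eta = L + (Bu + Bv) / eta + 1 by rewrite /c divfK// gt_eqF.
pose Phi (p : 'rV[R]_n * 'rV[R]_n) := u p.1 - v p.2 - c * enorm (p.1 - p.2) ^+ 2.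
have split_uv x y : u x - v y <= (u x - phi x) - (v y - phi y) + L * enorm (x - y).
  by have := le_trans (ler_norm _) (phiL x y); lra.
have apart x y : eta <= enorm (x - y) -> Phi (x, y) <= 0.
  move=> et; rewrite /Phi/=; have := split_uv x y.
  set t := enorm (x - y) in et *.
  have t0 : 0 < t by exact: lt_le_trans et.
  have : Bu + Bv <= (Bu + Bv) / eta * t.
    by rewrite mulrAC ler_pdivlMr// ler_wpM2l// addr_ge0.
  have : c * eta * t <= c * t ^+ 2.
    by rewrite expr2 mulrA ler_wpM2r ?(ltW t0)// ler_wpM2l// ltW.
  rewrite ceta; have := uB x; have := vB y.
  by rewrite !ler_norml => /andP[? ?] /andP[? ?]; lra.
pose rho := `|ru| + `|rv| + eta + `|x0|.
have far x y : rho < `|x| \/ rho < `|y| -> Phi (x, y) <= M.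
  move=> xy; have [et|te] := leP eta (enorm (x - y)).
    by apply: le_trans (apart _ _ et) (ltW M0).
  have nxy : `|x - y| < eta by exact: le_lt_trans (mx_norm_le_enorm _) te.
  have xr : ru < `|x| /\ rv < `|y|.
    have := ler_norm ru; have := ler_norm rv; have := normr_ge0 ru.
    have := normr_ge0 rv; have := normr_ge0 x0.
    have : `|x| <= `|x - y| + `|y| by rewrite -{1}(subrK y x) ler_normD.
    have : `|y| <= `|x - y| + `|x| by rewrite distrC -{1}(subrK x y) ler_normD.
    move: xy; rewrite /rho => + ? ? ? ? ? ? ?.
    by move=> [? | ?]; split; lra.
  have := uru x (lt_le_trans xr.1 (mx_norm_le_enorm _)).
  have := vrv y (lt_le_trans xr.2 (mx_norm_le_enorm _)).
  rewrite !ltr_norml => /andP[? ?] /andP[? ?].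
  have := split_uv x y; rewrite /Phi/=.
  have : L * enorm (x - y) <= L * eta by rewrite ler_wpM2l// ltW.
  have : 0 <= c * enorm (x - y) ^+ 2 by rewrite mulr_ge0 ?sqr_ge0// ltW.
  by lra.
pose D := [set x : 'rV[R]_n | `|x| <= rho].
have cD : compact D by exact: compact_le_mx_norm.
have Dx0 : D x0 by rewrite /D/= /rho lerDr !addr_ge0// ltW.
have cPhi : continuous Phi.
  move=> p; apply: cvgB.
    apply: cvgB.
      by apply: continuous_comp; [exact: cvg_fst|exact: cu].
    by apply: continuous_comp; [exact: cvg_snd|exact: cv].
  apply: cvgM; first exact: cvg_cst.
  apply: (@continuous_comp _ _ _ (fun q : 'rV[R]_n * 'rV[R]_n => enorm (q.1 - q.2))
    (fun t : R => t ^+ 2)); last exact: exprn_continuous.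
  apply: (@continuous_comp _ _ _ (fun q : 'rV[R]_n * 'rV[R]_n => q.1 - q.2) enorm);
    last exact: continuous_enorm.
  by apply: cvgB; [exact: cvg_fst|exact: cvg_snd].
have [[a b] _ abmax] := compact_EVT_max
  (ex_intro _ (x0, x0) (conj Dx0 Dx0)) (compact_setX cD cD)
  (continuous_subspaceT cPhi).
have MPhi : M <= Phi (a, b).
  have := abmax (x0, x0); rewrite inE => /(_ (conj Dx0 Dx0)).
  by rewrite {1}/Phi/= subrr enorm0 expr0n/= mulr0 subr0.
exists c, a, b; split=> //.
- by rewrite ltNge; apply/negP => /apart; rewrite leNgt (lt_le_trans M0).
- by apply: le_trans MPhi _; rewrite /Phi/= gerBl mulr_ge0 ?sqr_ge0// ltW.
move=> x y; have [xr|rx] := leP (`|x|) rho; last first.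
  by apply: le_trans (far x y _) MPhi; left.
have [yr|ry] := leP (`|y|) rho; last first.
  by apply: le_trans (far x y _) MPhi; right.
by apply: (abmax (x, y)); rewrite inE.
Qed.

End doubling.

(** * Comparison of the nonlocal operators at a doubling maximum *)

Section nonlocal_comparison.
Context {R : realType} {n : nat}.
Implicit Types (x y : 'rV[R]_n) (w phi u v : 'rV[R]_n -> R).

Lemma continuous_delta w x : continuous w -> continuous (delta w x).
Proof.
move=> cw.
have cD : continuous (fun y : 'rV[R]_n => x + y).
  by move=> y; apply: (@cvgD _ _ _ (nbhs y) _ (fun=> x) id); [exact: cvg_cst|exact: cvg_id].
have cB : continuous (fun y : 'rV[R]_n => x - y).
  by move=> y; apply: (@cvgB _ _ _ (nbhs y) _ (fun=> x) id); [exact: cvg_cst|exact: cvg_id].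
have cwD : continuous (fun y => w (x + y)).
  by move=> y; exact: continuous_comp (cD y) (cw _).
have cwB : continuous (fun y => w (x - y)).
  by move=> y; exact: continuous_comp (cB y) (cw _).
by move=> y; exact: cvgB (cvgD (cwD y) (cwB y)) (cvg_cst _).
Qed.

(** The constant terms of the paraboloids are those for which they take the
values [u a] and [v b] at the points of contact. The constant [K] depends
on [c] but not on [r], so the error disappears as [r] tends to [0]. *)
Lemma nonlocal_op_doubling_le (F : R -> R) (sigma L1 B L c : R) phi u v (a b : 'rV[R]_n) :
  (0 < n)%N -> 1 < sigma -> sigma < 2 ->
  continuous F -> {homo F : s t / s <= t} -> 0 <= L1 ->
  (forall t, `|F t| <= L1 * `|t|) ->
  continuous u -> continuous v -> 0 <= B -> 0 <= L -> 0 <= c ->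
  (forall z, `|u z - phi z| <= B) -> (forall z, `|v z - phi z| <= B) ->
  (forall z z', `|phi z - phi z'| <= L * enorm (z - z')) ->
  (forall x y, u x - v y - c * enorm (x - y) ^+ 2 <=
               u a - v b - c * enorm (a - b) ^+ 2) ->
  exists2 K : R, 0 <= K & forall r, 0 < r ->
    (nonlocal_op F sigma (patch u (ball a r)
       (paraboloid (u a - c * enorm (a - b) ^+ 2) c b)) a <=
     nonlocal_op F sigma (patch v (ball b r)
       (paraboloid (v b + c * enorm (a - b) ^+ 2) (- c) a)) b +
     (K * r `^ (2 - sigma))%:E)%E.
Proof.
move=> n0 sigma1 sigma2 cF mF L10 FL cu cv B0 L0 c0 uB vB phiL abmax.
have [C C0 intC] := integral_kernel_in sigma1 sigma2 n0.
exists (2 * (L1 * (2 * c)) * C); first by rewrite !mulr_ge0.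
move=> r r0; set P := paraboloid _ c b; set Q := paraboloid _ (- c) a.
have Pa : P a = u a by rewrite /P /paraboloid subrK.
have Qb : Q b = v b by rewrite /Q /paraboloid enorm_distC mulNr addrK.
rewrite /nonlocal_op.
under eq_integral do rewrite delta_patch_ball// delta_paraboloid.
under [X in (_ <= X + _)%E]eq_integral do
  rewrite delta_patch_ball// delta_paraboloid mulrN.
pose h (w : 'rV[R]_n -> R) (s : R) x y :=
  F (if `|y| < r then s * enorm y ^+ 2 else delta w x y).
have mh w s x : continuous w -> measurable_fun [set: 'rV[R]_n] (h w s x).
  move=> cw; apply: measurableT_comp; first exact: continuous_measurable_fun.
  have mn : measurable_fun [set: 'rV[R]_n] (fun y : 'rV[R]_n => `|y|).
    by apply: continuous_measurable_rV; exact: norm_continuous.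
  apply: measurable_fun_ifT.
  - exact: measurable_fun_ltr.
  - apply: measurable_funM => //; apply: measurable_funX.
    by apply: continuous_measurable_rV; exact: continuous_enorm.
  - by apply: continuous_measurable_rV; exact: continuous_delta.
have h_in w s x y : `|s| = 2 * c -> `|y| < r ->
    `|h w s x y| <= L1 * (2 * c) * enorm y ^+ 2.
  move=> s2c yr; rewrite /h yr (le_trans (FL _))// -mulrA ler_wpM2l//.
  by rewrite normrM s2c ger0_norm ?sqr_ge0.
(* For [|y| >= r] the constant [4 B] is absorbed in the linear term, since
   [1 <= |y| / r]. *)
have h_out w s x y : (forall z, `|w z - phi z| <= B) -> r <= `|y| ->
    `|h w s x y| <= L1 * (4 * B / r + 2 * L) * enorm y.
  move=> wB ry; rewrite /h ltNge ry/= (le_trans (FL _))// -mulrA ler_wpM2l//.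
  rewrite (le_trans (delta_le_growth x y wB phiL))// [leRHS]mulrDl lerD2r.
  rewrite mulrAC ler_pdivlMr// ler_wpM2l ?mulr_ge0//.
  exact: le_trans ry (mx_norm_le_enorm y).
have abs2c : `|2 * c| = 2 * c by rewrite ger0_norm// mulr_ge0.
have := @le_integral_kernel _ _ _ sigma1 sigma2 n0 (h u (2 * c) a) (h v (- (2 * c)) b)
  (L1 * (2 * c)) (L1 * (4 * B / r + 2 * L)) r r0 (mh _ _ _ cu) (mh _ _ _ cv).
move=> /(_ _ _ _ _ _)/le_trans; apply.
- by move=> y; exact: h_in.
- by move=> y; apply: h_in; rewrite normrN.
- by move=> y; exact: h_out.
- by move=> y; exact: h_out.
(* Both points are moved by the same vector, which keeps the penalty. *)
- move=> y ry; rewrite /h ltNge ry/=; apply: mF; rewrite /delta.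
  have := abmax (a + y) (b + y); have := abmax (a - y) (b - y).
  have -> : a + y - (b + y) = a - b by rewrite opprD addrACA subrr addr0.
  have -> : a - y - (b - y) = a - b by rewrite opprB addrA subrK.
  by lra.
apply: leeD; first exact: lexx.
rewrite -(mulrA _ C) [leRHS]EFinM lee_wpmul2l//.
  by rewrite lee_fin !mulr_ge0.
exact: intC.
Qed.

End nonlocal_comparison.

(** * The comparison principle *)

Theorem theorem1p1 (R : realType) (n : nat) (hn : (0 < n)%N)
    (sigma : R) (hsigma : 1 < sigma < 2)
    (L1 L2 L3 L4 L5 mu : R) (hmu : 0 < mu)
    (F : R -> R)
    (F_derivable : forall t : R, derivable F t 1)
    (F_C1 : continuous (derive1 F))
    (F0 : F 0 = 0)
    (F_lip : (lip_const (fun s t : R => `|s - t|%R) F < L1%:E)%E)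
    (F_incr : forall t : R, 0 < derive1 F t)
    (g : 'rV[R]_n -> R -> R)
    (g_lip : forall x x' t, x <> x' -> `|g x t - g x' t| < L2 * enorm (x - x'))
    (g_mono : forall x s t, s < t -> mu * (t - s) <= g x t - g x s)
    (g0 : forall x, g x 0 = 0)
    (phi : 'rV[R]_n -> R)
    (phi_convex : convex_function [set: 'rV[R]_n] phi)
    (phi_C11 : C11_on [set: 'rV[R]_n] phi)
    (phi_hessian : {ae lebesgue_rV n, forall x, forall xi : 'rV[R]_n,
      0 <= (xi *m hessian phi x *m xi^T) ord0 ord0 <= L3 * enorm xi ^+ 2})
    (phi_lip : (lip_const (fun x y : 'rV[R]_n => enorm (x - y)%R) phi <= L4%:E)%E)
    (phi_int : (\int[lebesgue_rV n]_y
      (`|phi y| / (1 + enorm y) `^ (n%:R + sigma))%:E <= L5%:E)%E)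
    (u v : 'rV[R]_n -> R)
    (u_cont : continuous u)
    (v_cont : continuous v)
    (u_sub : viscosity_subsolution F sigma [set: 'rV[R]_n]
      (fun x => g x (u x - phi x)) u)
    (u_infty : vanishes_at_infinity (fun x => u x - phi x))
    (v_super : viscosity_supersolution F sigma [set: 'rV[R]_n]
      (fun x => g x (v x - phi x)) v)
    (v_infty : vanishes_at_infinity (fun x => v x - phi x)) :
  forall x, u x <= v x.
Proof.
have [sigma1 sigma2] := andP hsigma.
have F_le s t : `|F s - F t| <= L1 * `|s - t|.
  have [->|/eqP st] := eqVneq s t; first by rewrite !subrr normr0 mulr0.
  apply: (lip_const_le (ltW F_lip) st).
  by rewrite normr_gt0 subr_eq0; exact/eqP.
have L10 : 0 <= L1.
  by have := le_trans (normr_ge0 _) (F_le 1 0); rewrite subr0 normr1 mulr1.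
have FL t : `|F t| <= L1 * `|t| by have := F_le t 0; rewrite F0 !subr0.
have cF : continuous F.
  move=> t; apply: differentiable_continuous; exact/derivable1_diffP.
have phiL x y := @lip_const_enorm_le R n phi L4 x y phi_lip.
have cphi : continuous phi.
  by move=> x; apply: differentiable_continuous; exact: phi_C11.1.
have cuphi : continuous (fun x => u x - phi x).
  by move=> x; exact: cvgB (u_cont x) (cphi x).
have cvphi : continuous (fun x => v x - phi x).
  by move=> x; exact: cvgB (v_cont x) (cphi x).
have [Bu Bu0 uB] := vanishing_bounded cuphi u_infty.
have [Bv Bv0 vB] := vanishing_bounded cvphi v_infty.
move=> x0; rewrite leNgt; apply/negP => uv0.
set M := u x0 - v x0.
have M0 : 0 < M by rewrite subr_gt0.
(* The first bound on [|a - b|] absorbs the Lipschitz constant of [phi], the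
   second one that of [g] in space. *)
pose eta := Num.min (M / (4 * (`|L4| + 1))) (mu * M / (4 * (`|L2| + 1))).
have eta0 : 0 < eta.
  by rewrite lt_min !divr_gt0 ?mulr_gt0// ltr_wpDl.
have etaL4 : 4 * `|L4| * eta <= M.
  have : eta <= M / (4 * (`|L4| + 1)) by rewrite ge_min lexx.
  by rewrite ler_pdivlMr ?mulr_gt0 ?ltr_wpDl//; lra.
have etaL2 : 4 * (`|L2| * eta) < mu * M.
  have : eta <= mu * M / (4 * (`|L2| + 1)) by rewrite ge_min lexx orbT.
  by rewrite ler_pdivlMr ?mulr_gt0 ?ltr_wpDl//; lra.
have [c [a [b [c0 ab Mab abmax]]]] :=
  doubling_max u_cont v_cont cphi (normr_ge0 L4) phiL u_infty v_infty eta0 etaL4 uv0.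
have uB' z : `|u z - phi z| <= Bu + Bv by rewrite (le_trans (uB z))// lerDl.
have vB' z : `|v z - phi z| <= Bu + Bv by rewrite (le_trans (vB z))// lerDr.
have F_homo := derive1_gt0_homo F_derivable F_incr.
have [K K0 IK] := nonlocal_op_doubling_le hn sigma1 sigma2 cF F_homo L10 FL
  u_cont v_cont (addr_ge0 Bu0 Bv0) (normr_ge0 L4) (ltW c0) uB' vB' phiL abmax.
have gab : g a (u a - phi a) <= g b (v b - phi b).
  apply: (@le_of_le_powR _ _ _ K (2 - sigma)) => // [|r r0]; first by rewrite subr_gt0.
  have [_ _ utest] := u_sub; have [_ _ vtest] := v_super.
  have oB z : open (ball z r : set 'rV[R]_n) by exact: ball_open.
  have Bz (z : 'rV[R]_n) : ball z r z by exact: ballxx.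
  have := utest a (ball a r) _ I (oB a) (Bz a) (C11_paraboloid _ _ c b) _ _.
  move=> /(_ (u a - c * enorm (a - b) ^+ 2)); rewrite {1}/paraboloid subrK.
  move=> /(_ erefl) uI.
  have {}uI : ((g a (u a - phi a))%:E <= nonlocal_op F sigma (patch u (ball a r)
      (paraboloid (u a - c * enorm (a - b) ^+ 2) c b)) a)%E.
    apply: uI => z _; have := abmax z b; rewrite /paraboloid; lra.
  have := vtest b (ball b r) _ I (oB b) (Bz b) (C11_paraboloid _ _ (- c) a) _ _.
  move=> /(_ (v b + c * enorm (a - b) ^+ 2)).
  rewrite {1}/paraboloid (enorm_distC b a) mulNr addrK => /(_ erefl) vI.
  have {}vI : (nonlocal_op F sigma (patch v (ball b r)
      (paraboloid (v b + c * enorm (a - b) ^+ 2) (- c) a)) b <=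
      (g b (v b - phi b))%:E)%E.
    by apply: vI => z _; have := abmax a z; rewrite /paraboloid (enorm_distC z a); lra.
  rewrite -lee_fin EFinD; apply: le_trans uI _; apply: le_trans (IK r r0) _.
  by rewrite leeD2r.
have ab_eta : `|L2| * enorm (a - b) <= `|L2| * eta by rewrite ler_wpM2l// ltW.
have gap : M / 2 <= (u a - phi a) - (v b - phi b).
  have : `|L4| * enorm (a - b) <= `|L4| * eta by rewrite ler_wpM2l// ltW.
  by have := le_trans (ler_norm _) (phiL a b); rewrite -/M in Mab; lra.
have g_gap : mu * (M / 2) <= g a (u a - phi a) - g a (v b - phi b).
  apply: le_trans (g_mono a _ _ _); last by lra.
  by rewrite ler_wpM2l// ltW.
have g_x : `|g a (v b - phi b) - g b (v b - phi b)| <= `|L2| * enorm (a - b).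
  have [->|/eqP nab] := eqVneq a b; first by rewrite subrr normr0 mulr_ge0 ?enorm_ge0.
  apply: le_trans (ltW (g_lip _ _ _ nab)) _.
  by rewrite ler_wpM2r ?enorm_ge0 ?ler_norm.
by move: g_x; rewrite ler_norml => /andP[? ?]; lra.
Qed.
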